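(* Let $\mathcal{T}$ be the triadic monoid, i.e. the monoid of all affine functions $\mathbb{Z}_{12} \to \mathbb{Z}_{12}$ which preserve the $C$-chord $\{0,4,7\}$ as a set. Suppose $\mathcal{S} \subseteq \mathbb{Z}_{12}$ is closed under the natural $\mathcal{T}$-action, in the sense that $\psi(s) \in \mathcal{S}$ for all $\psi\in\mathcal{T}$ and $s \in \mathcal{S}$. Assume further that $\mathcal{S}$ is covered by consonant triads, and let $\mathbb{S}$ be the collection of all consonant triads $Y$ with $Y \subseteq \mathcal{S}$. If $\mathbb{S}$ admits a simply transitive action of a subgroup $G$ of the $PLR$-group, then $\mathcal{S}$ is one of the following seven sets: \begin{itemize} \item $\{0,4,7\}$, \item $\{0,3,4,7\}$, \item $\{0,3,4,7,8,11\}$, \item $\{0,1,3,4,6,7,9,10\}$, \item $\{0,1,4,6,7,10\}$, \item $\{0,1,2,4,6,7,8,10\}$, \item $\mathbb{Z}_{12}$. \end{itemize}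
   Context: A map $\psi\colon \mathbb{Z}_{12}\to\mathbb{Z}_{12}$ is affine if it has the form $z\mapsto mz+b$ for some $m,b\in\mathbb{Z}_{12}$ ($m$ need not be invertible). It preserves $\{0,4,7\}$ as a set if $\psi(\{0,4,7\})\subseteq\{0,4,7\}$. The consonant triads are the 24 subsets of $\mathbb{Z}_{12}$ given by the major triads $\{n,n+4,n+7\}$ and the minor triads $\{n,n+3,n+7\}$, $n\in\mathbb{Z}_{12}$. A set $\mathcal{S}\subseteq \mathbb{Z}_{12}$ is covered by consonant triads if it is the union of the consonant triads contained in it. The (neo-Riemannian) $PLR$-group is the group of permutations of the set of 24 consonant triads generated by the following three involutions, for $n \in \mathbb{Z}_{12}$: $P$ exchanges $\{n,n+4,n+7\}$ and $\{n,n+3,n+7\}$; $L$ exchanges $\{n,n+4,n+7\}$ and $\{n+4,n+7,n+11\}$; $R$ exchanges $\{n,n+4,n+7\}$ and $\{n+9,n,n+4\}$. That $\mathbb{S}$ admits a simply transitive action of a subgroup $G$ of the $PLR$-group means that the natural action of $G$ on consonant triads maps $\mathbb{S}$ to itself and the resulting action of $G$ on $\mathbb{S}$ is simply transitive: $\mathbb{S}$ is nonempty, and for any $X,Y\in\mathbb{S}$ there is exactly one $g\in G$ with $gX=Y$. *)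

(* Defs.v *)
From HB Require Import structures.
From mathcomp Require Import all_boot all_order all_fingroup all_algebra.

Set Implicit Arguments.
Unset Strict Implicit.
Unset Printing Implicit Defensive.

Import GRing.Theory.
Local Open Scope ring_scope.

Definition C_chord : {set 'Z_12} := [set 0; 4; 7].

Definition affine_map (psi : 'Z_12 -> 'Z_12) : Prop :=
  exists m b : 'Z_12, forall z, psi z = m * z + b.

Definition in_triadic_monoid (psi : 'Z_12 -> 'Z_12) : Prop :=
  affine_map psi /\ psi @: C_chord \subset C_chord.

Lemma in_triadic_monoid_id : in_triadic_monoid id.
Proof.
split; last by rewrite imset_id.
by exists 1, 0 => z; rewrite mul1r addr0.
Qed.

Lemma in_triadic_monoid_comp (f g : 'Z_12 -> 'Z_12) :
  in_triadic_monoid f -> in_triadic_monoid g -> in_triadic_monoid (f \o g).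
Proof.
move=> [[m [b fE]] fC] [[m' [b' gE]] gC]; split.
  by exists (m * m'), (m * b' + b) => z /=; rewrite fE gE mulrDr mulrA addrA.
by rewrite imset_comp (subset_trans _ fC) // imsetS.
Qed.

Definition triadic_closed (S : {set 'Z_12}) : Prop :=
  forall psi : 'Z_12 -> 'Z_12, in_triadic_monoid psi ->
  forall s, s \in S -> psi s \in S.

Definition major_set (n : 'Z_12) : {set 'Z_12} := [set n; n + 4; n + 7].
Definition minor_set (n : 'Z_12) : {set 'Z_12} := [set n; n + 3; n + 7].

Definition consonant (Y : {set 'Z_12}) : bool :=
  [exists n, (Y == major_set n) || (Y == minor_set n)].

Record triad : Type := Triad {
  triad_set :> {set 'Z_12};
  triad_consonant : consonant triad_set
}.

HB.instance Definition _ := [isSub for triad_set].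
HB.instance Definition _ := [Finite of triad by <:].

Lemma major_consonant n : consonant (major_set n).
Proof. by apply/existsP; exists n; rewrite eqxx. Qed.

Lemma minor_consonant n : consonant (minor_set n).
Proof. by apply/existsP; exists n; rewrite eqxx orbT. Qed.

Definition major (n : 'Z_12) : triad := Triad (major_consonant n).
Definition minor (n : 'Z_12) : triad := Triad (minor_consonant n).

Definition triads_in (S : {set 'Z_12}) : {set triad} :=
  [set Y : triad | triad_set Y \subset S].

Definition covered_by_triads (S : {set 'Z_12}) : Prop :=
  S = \bigcup_(Y in triads_in S) triad_set Y.

(* The transpositions in each product below are pairwise disjoint, so the order
   of the factors is irrelevant.  For [L] and [R], note that
   {n+4, n+7, n+11} = minor_set (n + 4) and {n+9, n, n+4} = minor_set (n + 9). *)
Definition plr_P : {perm triad} :=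
  (\prod_(n : 'Z_12) tperm (major n) (minor n))%g.
Definition plr_L : {perm triad} :=
  (\prod_(n : 'Z_12) tperm (major n) (minor (n + 4)))%g.
Definition plr_R : {perm triad} :=
  (\prod_(n : 'Z_12) tperm (major n) (minor (n + 9)))%g.

Definition PLR_group : {group {perm triad}} := <<[set plr_P; plr_L; plr_R]>>%G.

Lemma minor_L n : triad_set (minor (n + 4)) = [set n + 4; n + 7; n + 11].
Proof.
have e3 : n + 4 + 3 = n + 7.
  by rewrite -(_ : 4 + 3 = 7 :> 'Z_12) ?addrA //; apply/val_inj.
have e7 : n + 4 + 7 = n + 11.
  by rewrite -(_ : 4 + 7 = 11 :> 'Z_12) ?addrA //; apply/val_inj.
by rewrite /= /minor_set e3 e7.
Qed.

Lemma minor_R n : triad_set (minor (n + 9)) = [set n + 9; n; n + 4].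
Proof.
have e3 : n + 9 + 3 = n.
  by rewrite -[RHS]addr0 -(_ : 9 + 3 = 0) ?addrA //; apply/val_inj.
have e7 : n + 9 + 7 = n + 4.
  by rewrite -(_ : 9 + 7 = 4 :> 'Z_12) ?addrA //; apply/val_inj.
by rewrite /= /minor_set e3 e7.
Qed.

Lemma eq_shift_set3 (n a b m a' b' : 'Z_12) :
  [set n; n + a; n + b] = [set m; m + a'; m + b'] ->
  exists2 d, n = m + d & all [in [:: 0; a'; b']] [:: d; d + a; d + b].
Proof.
have mem3 (k x y z : 'Z_12) :
    (k + x \in [set k; k + y; k + z]) = (x \in [:: 0; y; z]).
  by rewrite !inE -subr_eq0 addrAC subrr add0r !(inj_eq (addrI k)) orbA.
move=> /setP e; exists (n - m); first by rewrite addrCA subrr addr0.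
apply/allP => x xd; rewrite -(mem3 m) -e.
have -> : m + x = n + (x - (n - m)).
  by rewrite opprB addrCA [m - n]addrC addNKr addrC.
rewrite mem3; move: xd; rewrite !inE => /or3P[] /eqP ->.
- by rewrite subrr eqxx.
- by rewrite addrAC subrr add0r eqxx orbT.
- by rewrite addrAC subrr add0r eqxx !orbT.
Qed.

Lemma major_inj : injective major.
Proof.
move=> n m /(congr1 triad_set) /eq_shift_set3[d -> d_in].
suff -> : d = 0 by rewrite addr0.
by case: d d_in; do 12?[case=> [? |]] => // *; apply/val_inj.
Qed.

Lemma minor_inj : injective minor.
Proof.
move=> n m /(congr1 triad_set) /eq_shift_set3[d -> d_in].
suff -> : d = 0 by rewrite addr0.
by case: d d_in; do 12?[case=> [? |]] => // *; apply/val_inj.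
Qed.

Lemma major_neq_minor n m : major n != minor m.
Proof.
apply/eqP => /(congr1 triad_set) /eq_shift_set3[d _].
by case: d; do 12?[case=> [? |]].
Qed.

Lemma prod_tpermE (f g : 'Z_12 -> triad) (n : 'Z_12) :
  injective f -> injective g -> (forall i j, f i != g j) ->
  let t : {perm triad} := (\prod_(i : 'Z_12) tperm (f i) (g i))%g in
  t (f n) = g n /\ t (g n) = f n.
Proof.
move=> f_inj g_inj fg /=.
have gf i j : g i != f j by rewrite eq_sym.
suff main (s : seq 'Z_12) : uniq s ->
    (\prod_(i <- s) tperm (f i) (g i))%g (f n) = (if n \in s then g n else f n) /\
    (\prod_(i <- s) tperm (f i) (g i))%g (g n) = (if n \in s then f n else g n).
  by have := main _ (index_enum_uniq _); rewrite mem_index_enum.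
elim: s => [|i s IHs] /=; first by rewrite big_nil !perm1.
case/andP=> i_s /IHs [IHf IHg]; rewrite big_cons !permM in_cons.
have [e|ni] := eqVneq n i.
  by rewrite -e in i_s *; rewrite tpermL tpermR IHf IHg (negPf i_s).
have in' : i != n by rewrite eq_sym.
by rewrite !tpermD ?(inj_eq f_inj) ?(inj_eq g_inj).
Qed.

Lemma minor_shift_inj (k : 'Z_12) : injective (fun n => minor (n + k)).
Proof. by move=> n m /minor_inj /addIr. Qed.

Lemma plr_PE n : plr_P (major n) = minor n /\ plr_P (minor n) = major n.
Proof.
by apply: prod_tpermE major_inj minor_inj _; exact: major_neq_minor.
Qed.

Lemma plr_LE n :
  plr_L (major n) = minor (n + 4) /\ plr_L (minor (n + 4)) = major n.
Proof.
apply: (prod_tpermE n major_inj (@minor_shift_inj 4)) => i j.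
exact: major_neq_minor.
Qed.

Lemma plr_RE n :
  plr_R (major n) = minor (n + 9) /\ plr_R (minor (n + 9)) = major n.
Proof.
apply: (prod_tpermE n major_inj (@minor_shift_inj 9)) => i j.
exact: major_neq_minor.
Qed.

Definition simply_transitive (T : finType) (G : {group {perm T}})
    (A : {set T}) : Prop :=
  [/\ [acts G, on A | 'P],
      A != set0
    & forall X Y, X \in A -> Y \in A -> exists! g, g \in G /\ g X = Y].

(* Main.v *)
(* Every element of the PLR-group either translates the major triads by some k
   and the minor triads by -k (a "Schritt"), or exchanges the two classes in the
   same contragredient manner (a "Wechsel").  In particular it is determined by
   the image of a single triad, so a simply transitive action on the triads
   contained in S forces each Schritt or Wechsel sending the C major triad to a
   triad in S to preserve the set of these triads.  The triadic monoid is
   generated by 3z + 7 and 8z + 4; among the 2^12 subsets of Z/12, only the seven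
   listed ones are nonempty, closed under these two maps, covered by triads, and
   satisfy this symmetry condition. *)

Require Import Defs.
From mathcomp Require Import all_boot all_order all_fingroup all_algebra.

Set Implicit Arguments.
Unset Strict Implicit.
Unset Printing Implicit Defensive.

Import GRing.Theory.
Local Open Scope ring_scope.

(** * Schritte, Wechsel and their products *)

Definition schritt (k : 'Z_12) (g : {perm triad}) : Prop :=
  forall n, g (major n) = major (n + k) /\ g (minor (n + k)) = minor n.

Definition wechsel (k : 'Z_12) (g : {perm triad}) : Prop :=
  forall n, g (major n) = minor (n + k) /\ g (minor (n + k)) = major n.

Lemma schritt_mul k l g h :
  schritt k g -> schritt l h -> schritt (k + l) (g * h)%g.
Proof.
move=> gk hl n; have [gM gm] := gk n; have [hM hm] := hl (n + k).
rewrite !permM gM hM addrA; split=> //.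
by rewrite addrAC (gk (n + l)).2 (hl n).2.
Qed.

Lemma schritt_mul_wechsel k l g h :
  schritt k g -> wechsel l h -> wechsel (k + l) (g * h)%g.
Proof.
move=> gk hl n; rewrite !permM (gk n).1 (hl (n + k)).1 addrA; split=> //.
by rewrite addrAC (gk (n + l)).2 (hl n).2.
Qed.

Lemma wechsel_mul_schritt k l g h :
  wechsel k g -> schritt l h -> wechsel (k - l) (g * h)%g.
Proof.
(* Writing [n + k] as [n + k - l + l] puts the minor triad in the form that the second half of [hl]
   expects. *)
move=> gk hl n; rewrite !permM (gk n).1 -{1}[n + k](subrK l) (hl _).2 addrA.
by split=> //; rewrite addrAC (gk (n - l)).2 (hl (n - l)).1 subrK.
Qed.

Lemma wechsel_mul k l g h :
  wechsel k g -> wechsel l h -> schritt (k - l) (g * h)%g.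
Proof.
move=> gk hl n; rewrite !permM (gk n).1 -{1}[n + k](subrK l) (hl _).2 addrA.
by split=> //; rewrite addrAC (gk (n - l)).2 (hl (n - l)).1 subrK.
Qed.

(** [P], [L], [R] are Wechsel with parameters 0, 4, 9, and the two kinds together are stable under
    products. Finiteness of the group makes every element a product of generators, without
    inverses. *)
Lemma PLR_schritt_or_wechsel g :
  g \in PLR_group -> exists k, schritt k g \/ wechsel k g.
Proof.
case/gen_prodgP => n [c c_gen ->].
elim/big_ind: _ => [|x y [k [xk|xk]] [l [yl|yl]]|i _].
- by exists 0; left=> m; rewrite !perm1 addr0.
- by exists (k + l); left; apply: schritt_mul.
- by exists (k + l); right; apply: schritt_mul_wechsel.
- by exists (k - l); right; apply: wechsel_mul_schritt.
- by exists (k - l); left; apply: wechsel_mul.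
- have := c_gen i; rewrite !inE => /orP[/orP[]|] /eqP ->.
  + by exists 0; right=> m; rewrite addr0; apply: plr_PE.
  + by exists 4; right=> m; apply: plr_LE.
  + by exists 9; right=> m; apply: plr_RE.
Qed.

(** * Symmetries forced by simple transitivity *)

Section SimplyTransitive.

Variables (G : {group {perm triad}}) (A : {set triad}).
Hypotheses (G_sub : G \subset PLR_group) (G_st : simply_transitive G A).
Hypothesis A_major0 : major 0 \in A.

Lemma simply_transitive_closed g X : g \in G -> (g X \in A) = (X \in A).
Proof. by case: G_st => GA _ _ gG; rewrite -apermE (actsP GA). Qed.

(** Transitivity supplies [g] in [G] taking [major 0] to [major k]. A Wechsel would give a minor
    triad, so [g] is a Schritt, and its parameter is read off at [major 0]. *)
Lemma simply_transitive_schritt k : major k \in A ->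
  exists2 g, schritt k g & forall X, (g X \in A) = (X \in A).
Proof.
case: (G_st) => _ _ trans kA; have [g [[gG g0] _]] := trans _ _ A_major0 kA.
exists g; last by move=> X; apply: simply_transitive_closed.
have [l [gl|gl]] := PLR_schritt_or_wechsel (subsetP G_sub _ gG).
  by move: g0; rewrite (gl 0).1 add0r => /major_inj <-.
by have := major_neq_minor k (0 + l); rewrite -(gl 0).1 g0 eqxx.
Qed.

Lemma simply_transitive_wechsel k : minor k \in A ->
  exists2 g, wechsel k g & forall X, (g X \in A) = (X \in A).
Proof.
case: (G_st) => _ _ trans kA; have [g [[gG g0] _]] := trans _ _ A_major0 kA.
exists g; last by move=> X; apply: simply_transitive_closed.
have [l [gl|gl]] := PLR_schritt_or_wechsel (subsetP G_sub _ gG).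
  by have := major_neq_minor (0 + l) k; rewrite -(gl 0).1 g0 eqxx.
by move: g0; rewrite (gl 0).1 add0r => /minor_inj <-.
Qed.

End SimplyTransitive.

(* Subsets of Z/12 are encoded by their indicator sequence, of size 12. *)
Section BitEncoding.

Variable s : bitseq.

Definition bit (i : nat) : bool := nth false s (i %% 12).
Definition major_bits (n : nat) : bool := [&& bit n, bit (n + 4) & bit (n + 7)].
Definition minor_bits (n : nat) : bool := [&& bit n, bit (n + 3) & bit (n + 7)].

Definition triadic_bits : bool :=
  has bit (iota 0 12) &&
  all (fun i => bit i ==> bit (3 * i + 7) && bit (8 * i + 4)) (iota 0 12).

(* Subtraction of 4, 7 and 3 is written as addition of 8, 5 and 9. *)
Definition covered_bits : bool :=
  all (fun i => bit i ==>
    [|| major_bits i, major_bits (i + 8), major_bits (i + 5),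
        minor_bits i, minor_bits (i + 9) | minor_bits (i + 5)]) (iota 0 12).

(** Minor triads move by [-k], but a set is invariant under translation by [-k] exactly when it is
    under [k]. *)
Definition schritt_bits (k : nat) : bool :=
  all (fun n => (major_bits n == major_bits (n + k)) &&
                (minor_bits n == minor_bits (n + k))) (iota 0 12).
Definition wechsel_bits (k : nat) : bool :=
  all (fun n => major_bits n == minor_bits (n + k)) (iota 0 12).
Definition symmetric_bits : bool :=
  all (fun k => (major_bits k ==> schritt_bits k) &&
                (minor_bits k ==> wechsel_bits k)) (iota 0 12).

End BitEncoding.

Definition bitseqs (n : nat) : seq bitseq :=
  iter n (fun ss => [seq b :: s | b <- [:: false; true], s <- ss]) [:: [::]].

Lemma mem_bitseqs n s : size s = n -> s \in bitseqs n.
Proof.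
elim: n s => [|n IHn] [|b s] // [/IHn sn]; apply/allpairsPdep.
by exists b, s; split=> //=; case: b.
Qed.

Definition symmetric_sets : seq (seq nat) :=
  [:: [:: 0; 4; 7]; [:: 0; 3; 4; 7]; [:: 0; 3; 4; 7; 8; 11];
      [:: 0; 1; 3; 4; 6; 7; 9; 10]; [:: 0; 1; 4; 6; 7; 10];
      [:: 0; 1; 2; 4; 6; 7; 8; 10]; iota 0 12]%N.

(* The filters are nested, not conjoined, because [vm_compute] evaluates both
   arguments of [&&]. *)
Lemma symmetric_bits_classification :
  all (fun s => s \in [seq mkseq (mem l) 12 | l <- symmetric_sets])
    [seq s <- [seq s <- [seq s <- bitseqs 12 | triadic_bits s]
                      | covered_bits s]
            | symmetric_bits s].
Proof. by vm_compute. Qed.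

(** * From hypotheses on sets to tests on bit sequences *)

Definition bits_of (S : {set 'Z_12}) : bitseq :=
  mkseq (fun i => i%:R \in S) 12.

Lemma bit_bits_of S i : bit (bits_of S) i = (i%:R \in S).
Proof. by rewrite /bit nth_mkseq ?ltn_pmod // (@Zp_nat_mod 12). Qed.

Lemma set3_subset (T : finType) (x y z : T) (S : {set T}) :
  ([set x; y; z] \subset S) = [&& x \in S, y \in S & z \in S].
Proof. by rewrite !subUset !sub1set andbA. Qed.

Lemma major_bitsE S n :
  major_bits (bits_of S) n = (major n%:R \in triads_in S).
Proof. by rewrite inE set3_subset /major_bits !bit_bits_of !natrD. Qed.

Lemma minor_bitsE S n :
  minor_bits (bits_of S) n = (minor n%:R \in triads_in S).
Proof. by rewrite inE set3_subset /minor_bits !bit_bits_of !natrD. Qed.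

Lemma in_triadic_monoid_affine (m b : 'Z_12) :
  all (fun x => m * x + b \in [:: 0; 4; 7]) [:: 0; 4; 7] ->
  in_triadic_monoid (fun z => m * z + b).
Proof.
move=> /allP mb; split; first by exists m, b.
apply/subsetP => _ /imsetP[x xC ->].
suff /mb : x \in [:: 0; 4; 7] by rewrite !inE orbA.
by move: xC; rewrite !inE orbA.
Qed.

Lemma triadic_closed_bits S :
  triadic_closed S -> S != set0 -> triadic_bits (bits_of S).
Proof.
move=> S_closed /set0Pn[x xS]; apply/andP; split.
  apply/hasP; exists (x : nat); first by rewrite mem_iota ltn_ord.
  by rewrite bit_bits_of natr_Zp.
apply/allP => i _; rewrite !bit_bits_of; apply/implyP => iS.
rewrite !(natrM, natrD); apply/andP; split.
  (* [3z + 7] takes 0, 4, 7 to 7, 7, 4, and [8z + 4] takes them to 4, 0, 0. *)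
  exact: (S_closed _ (@in_triadic_monoid_affine 3 7 isT)).
exact: (S_closed _ (@in_triadic_monoid_affine 8 4 isT)).
Qed.

Lemma covered_by_triads_bits S :
  covered_by_triads S -> covered_bits (bits_of S).
Proof.
move=> S_covered; apply/allP => i _; rewrite bit_bits_of; apply/implyP.
rewrite {1}S_covered => /bigcupP[Y YS iY].
(* The residue [i] is the root, third or fifth of [Y]; these identities recover the root in the last
   two cases. *)
have e8 (n : 'Z_12) : n + 4 + 8 = n.
  by rewrite -addrA (_ : 4 + 8 = 0) ?addr0 //; apply/val_inj.
have e5 (n : 'Z_12) : n + 7 + 5 = n.
  by rewrite -addrA (_ : 7 + 5 = 0) ?addr0 //; apply/val_inj.
have e9 (n : 'Z_12) : n + 3 + 9 = n.
  by rewrite -addrA (_ : 3 + 9 = 0) ?addr0 //; apply/val_inj.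
have /existsP[n /orP[/eqP YE|/eqP YE]] := triad_consonant Y.
  have {YS} nS : major n \in triads_in S by move: YS; rewrite !inE /= YE.
  move: iY; rewrite YE !inE -orbA !major_bitsE !natrD.
  by case/or3P => /eqP ->; rewrite ?e8 ?e5 nS ?orbT.
have {YS} nS : minor n \in triads_in S by move: YS; rewrite !inE /= YE.
move: iY; rewrite YE !inE -orbA !minor_bitsE !natrD.
by case/or3P => /eqP ->; rewrite ?e9 ?e5 nS ?orbT.
Qed.

Lemma simply_transitive_bits S (G : {group {perm triad}}) :
    G \subset PLR_group -> simply_transitive G (triads_in S) ->
    major 0 \in triads_in S ->
  symmetric_bits (bits_of S).
Proof.
move=> G_sub G_st S0; apply/allP => k _.
apply/andP; split; apply/implyP; rewrite ?major_bitsE ?minor_bitsE => kS.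
  have [g gk gS] := simply_transitive_schritt G_sub G_st S0 kS.
  apply/allP => n _; rewrite !major_bitsE !minor_bitsE !natrD.
  (* Once [major (n + k)] and [minor n] are written as images under [g], invariance of membership
     removes [g]. *)
  by rewrite -(gk n%:R).1 -(gk n%:R).2 !gS !eqxx.
have [g gk gS] := simply_transitive_wechsel G_sub G_st S0 kS.
apply/allP => n _; rewrite major_bitsE minor_bitsE natrD.
by rewrite -(gk n%:R).1 gS.
Qed.

(** The constant maps to 0, 4 and 7 lie in the triadic monoid, so one point of [S] yields the whole
    C-chord. *)
Lemma triadic_closed_major0 S :
  triadic_closed S -> S != set0 -> major 0 \in triads_in S.
Proof.
move=> S_closed /set0Pn[x xS]; rewrite inE set3_subset !add0r.
have cst b : b \in [:: 0; 4; 7] -> b \in S.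
  move=> bC; suff -> : b = 0 * x + b.
    by apply: (S_closed (fun z => 0 * z + b)) xS;
       apply: in_triadic_monoid_affine; rewrite /= !mul0r !add0r bC.
  by rewrite mul0r add0r.
by rewrite !cst.
Qed.

Lemma bits_of_inj S (l : seq nat) :
  bits_of S = mkseq (mem l) 12 -> S = [set x : 'Z_12 | val x \in l].
Proof.
move=> E; apply/setP => x; rewrite inE -{1}[x]natr_Zp.
by rewrite -bit_bits_of /bit E modn_small ?nth_mkseq.
Qed.

Theorem theorem4p1 (S : {set 'Z_12})
    (S_closed : triadic_closed S)
    (S_covered : covered_by_triads S)
    (G : {group {perm triad}})
    (G_sub : G \subset PLR_group)
    (G_simply_transitive : simply_transitive G (triads_in S)) :
  S \in [:: [set 0; 4; 7];
            [set 0; 3; 4; 7];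
            [set 0; 3; 4; 7; 8; 11];
            [set 0; 1; 3; 4; 6; 7; 9; 10];
            [set 0; 1; 4; 6; 7; 10];
            [set 0; 1; 2; 4; 6; 7; 8; 10];
            [set: 'Z_12]].
Proof.
have S_neq0 : S != set0.
  (* The root of any triad in the nonempty set [triads_in S] is a point of [S]. *)
  case: G_simply_transitive => _ /set0Pn[Y YS] _; apply/set0Pn.
  have /existsP[n /orP[/eqP YE|/eqP YE]] := triad_consonant Y; exists n;
    by move: YS; rewrite inE YE set3_subset => /andP[].
have S0 := triadic_closed_major0 S_closed S_neq0.
have /(allP symmetric_bits_classification)/mapP[l l_sym /bits_of_inj ->] :
    bits_of S \in [seq s <- [seq s <- [seq s <- bitseqs 12 | triadic_bits s]
                                   | covered_bits s] | symmetric_bits s].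
  rewrite !mem_filter (simply_transitive_bits G_sub G_simply_transitive S0).
  rewrite covered_by_triads_bits // triadic_closed_bits //.
  by rewrite mem_bitseqs ?size_mkseq.
have -> : [:: [set 0; 4; 7];
              [set 0; 3; 4; 7];
              [set 0; 3; 4; 7; 8; 11];
              [set 0; 1; 3; 4; 6; 7; 9; 10];
              [set 0; 1; 4; 6; 7; 10];
              [set 0; 1; 2; 4; 6; 7; 8; 10];
              [set: 'Z_12]] =
    [seq [set x : 'Z_12 | val x \in l'] | l' <- symmetric_sets].
  (* The two lists agree in order, so they are compared set by set over the twelve residues. *)
  by congr [:: _; _; _; _; _; _; _]; apply/setP => x; rewrite !inE;
     case: x; do 12?[case=> [? |]].
exact: map_f.
Qed.
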